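(* Let $k\ge2$, let $r_{ij}=r_{ji}$ ($1\le i\ne j\le k$) be positive integers, and let $\Pi(r_{12},\dots,r_{k-1\,k})$ be the Gale dual type-A root polytope. Then $$h(\Pi(r_{12},\dots,r_{k-1\,k}),t+1)=\sum_{G\in\mathbb K_k'}t^{e(G)-k},$$ where $\mathbb K_k'$ is the set of subgraphs $G$ of $\mathbb K_k$ which have $k$ vertices, contain at least one directed cycle, and are rooted at the first vertex, and $e(G)$ is the number of edges of $G$.
   Context: **Polytope.** For $1\le i\ne j\le k$ let $\alpha_{ij}=\varepsilon_i-\varepsilon_j$ in $\mathfrak a_k^*=\{x\in\mathbb R^k: x_1+\dots+x_k=0\}$. Let $\mathfrak A=[\alpha_1,\dots,\alpha_n]$ be the sequence in which each $\alpha_{ij}$ (for every ordered pair $i\neq j$) is repeated $r_{ij}$ times; $n=2\sum_{i<j}r_{ij}$, $d=n-k+1$. Let $\mathfrak t$ be the dual of the $d$-dimensional space $\mathfrak t^*=\{m\in\mathbb R^n:\sum_i m_i\alpha_i=0\}$, and let $\beta_i\in\mathfrak t$ be the functional $m\mapsto m_i$ (the Gale dual sequence). $\Pi(r_{12},\dots,r_{k-1\,k})$ is the convex hull of $\beta_1,\dots,\beta_n$, a polytope of dimension $d-1$. **Graphs.** $\mathbb K_k$ is the directed multigraph on vertices $\{1,\dots,k\}$ with exactly $r_{ij}$ (distinguishable) edges from $i$ to $j$ for every ordered pair $i\ne j$. A subgraph with $k$ vertices is the full vertex set together with a subset of the edges. A directed graph is rooted at vertex $v$ if there is a directed path from every vertex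 to $v$. A pair of edges $i\to j$, $j\to i$ counts as a directed cycle. **$g$- and $h$-polynomials (Stanley).** For convex polytopes define inductively: $g(\emptyset,t)=h(\emptyset,t)=1$, $\dim\emptyset=-1$; for a polytope $P$ of dimension $D\ge 0$, $$h(P,t)=\sum_{F<P}g(F,t)(t-1)^{D-1-\dim F},$$ the sum over all proper faces $F$ of $P$ including the empty face; writing $h(P,t)=\sum_{i=0}^D h_it^i$, set $g(P,t)=h_0+\sum_{i=1}^{\lfloor D/2\rfloor}(h_i-h_{i-1})t^i$. *)

(* Defs.v *)
From HB Require Import structures.
From mathcomp Require Import all_boot all_order all_algebra.
From mathcomp Require Import boolp classical_sets functions cardinality fsbigop.
From mathcomp Require Import reals.
From mathcomp Require Import zify.

Set Implicit Arguments.
Unset Strict Implicit.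
Unset Printing Implicit Defensive.

Import Order.TTheory GRing.Theory Num.Theory.

Local Open Scope classical_set_scope.
Local Open Scope ring_scope.

Section Polytopes.
Variables (R : realType) (V : vectType R).
Implicit Types (A F P : set V) (f : set V -> {poly int}).

Definition conv_hull (I : finType) (v : I -> V) : set V :=
  [set x | exists w : I -> R,
     [/\ forall i, 0 <= w i, \sum_i w i = 1 & x = \sum_i w i *: v i]].

Definition in_affine_subspace A (d : nat) : Prop :=
  exists (x : V) (U : {vspace V}), \dim U = d /\ forall y, A y -> y - x \in U.

Lemma in_affine_subspace_ex A : exists d, `[< in_affine_subspace A d >].
Proof.
exists (\dim {:V}); apply/asboolP; exists 0, fullv; split=> // y _.
exact: memvf.
Qed.

(* The dimension of a set is that of its affine hull, the smallest affine
   subspace x + U containing it. *)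
Definition set_dim A : int :=
  if A == set0 then -1 else (ex_minn (in_affine_subspace_ex A))%:Z.

(* The choices (l, c) = (0, 1) and (0, 0) make set0 and P faces of P. *)
Definition face F P : Prop :=
  exists (l : 'Hom(V, R^o)) (c : R),
    (forall x, P x -> l x <= c :> R) /\ F = P `&` [set x | l x = c :> R].

Definition proper_face F P : Prop := face F P /\ F <> P.

(* A polytope has finitely many faces; \sum_(F \in _) is 0 on infinite supports.
   The exponent is nonnegative before absz, by proper_face_dim below. *)
Definition h_step f P : {poly int} :=
  if P == set0 then 1 else
  \sum_(F \in [set F | proper_face F P])
     f F * ('X - 1) ^+ absz (set_dim P - 1 - set_dim F)%R.

Definition g_step f P : {poly int} :=
  if P == set0 then 1 else
  let h := h_step f P in
  (h`_0)%:P + \sum_(1 <= i < (absz (set_dim P))./2.+1) (h`_i - h`_i.-1) *: 'X^i.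

(* m bounds set_dim P + 1; any such m gives the same value, and the equations
   defining g and h hold: see stanley_g_rec_stable, stanley_hE, stanley_gE. *)
Fixpoint stanley_g_rec (m : nat) : set V -> {poly int} :=
  if m is m'.+1 then g_step (stanley_g_rec m') else fun=> 1.

Definition stanley_g P : {poly int} := stanley_g_rec (absz (set_dim P + 1)%R) P.

Definition stanley_h P : {poly int} := h_step stanley_g P.

Lemma set_dim0 : set_dim set0 = -1.
Proof. by rewrite /set_dim eqxx. Qed.

Lemma set_dim_ge0 P : P != set0 -> 0 <= set_dim P.
Proof. by rewrite /set_dim => /negbTE ->. Qed.

Lemma set_dim_geN1 P : -1 <= set_dim P.
Proof. by rewrite /set_dim; case: ifP => // _; exact: le_trans (lerN10 _) _. Qed.

Lemma proper_face_dim F P : proper_face F P -> set_dim F < set_dim P.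
Proof.
move=> [[l [c [lec defF]]] neqFP].
have [F0|Fn0] := eqVneq F set0.
  rewrite F0 set_dim0; apply: lt_le_trans (ltrN10 _) _; apply: set_dim_ge0.
  by apply/eqP => P0; apply: neqFP; rewrite F0 P0.
have FP : F `<=` P by rewrite defF; exact: subIsetl.
have Pn0 : P != set0.
  by apply: contraNneq Fn0 => P0; apply/eqP; rewrite -subset0 -P0.
rewrite /set_dim (negbTE Fn0) (negbTE Pn0) ltz_nat.
case: ex_minnP => m _ minF; case: ex_minnP => d /asboolP[x [U [dimU PU]]] _.
have [y Py lyc] : exists2 y, P y & l y <> c.
  apply: contrapT => H; apply: neqFP; rewrite defF; apply/seteqP; split.
    exact: subIsetl.
  by move=> y Py; split=> //=; apply: contrapT => lyc; apply: H; exists y.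
have [z Fz] : exists z, F z by apply/set0P.
have lzc : l z = c by move: Fz; rewrite defF => -[].
have dimK : (\dim (U :&: lker l) < d)%N.
  rewrite -dimU ltn_neqAle dimvS ?capvSl // andbT.
  apply: contra_notN lyc => /eqP eqd.
  have /eqP UK : (U :&: lker l == U)%VS by rewrite eqEdim capvSl eqd leqnn.
  have : y - z \in U.
    have -> : y - z = (y - x) - (z - x) by rewrite opprB addrA subrK.
    by apply: rpredB; apply: PU => //; exact: FP.
  by rewrite -UK memv_cap => /andP[_]; rewrite memv_ker linearB /= lzc subr_eq0 => /eqP.
apply: leq_ltn_trans dimK; apply: minF; apply/asboolP.
exists z, (U :&: lker l)%VS; split=> // u Fu.
have luc : l u = c by move: Fu; rewrite defF => -[].
rewrite memv_cap memv_ker linearB /= lzc luc subrr eqxx andbT.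
have -> : u - z = (u - x) - (z - x) by rewrite opprB addrA subrK.
by apply: rpredB; apply: PU; exact: FP.
Qed.

Lemma eq_h_step f1 f2 P :
  (forall F, proper_face F P -> f1 F = f2 F) -> h_step f1 P = h_step f2 P.
Proof.
move=> eqf; rewrite /h_step; case: ifP => // _.
by apply: eq_fsbigr => F; rewrite inE => /eqf ->.
Qed.

Lemma stanley_g_rec_stable m n P :
  set_dim P + 1 <= m%:Z -> set_dim P + 1 <= n%:Z ->
  stanley_g_rec m P = stanley_g_rec n P.
Proof.
wlog: m n / (m <= n)%N => [H|].
  by case: (leqP m n) => [|/ltnW] mn Pm Pn; [|apply/esym]; exact: H.
elim: n m P => [|n IHn] [|m] P //= mn Pm Pn.
  have [-> | /set_dim_ge0] := eqVneq P set0; first by rewrite /g_step eqxx.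
  lia.
rewrite /g_step (@eq_h_step (stanley_g_rec m) (stanley_g_rec n)) // => F FP.
by have := proper_face_dim FP => ?; apply: IHn => //; lia.
Qed.

Lemma stanley_g0 : stanley_g set0 = 1.
Proof. by rewrite /stanley_g set_dim0. Qed.

Lemma stanley_h0 : stanley_h set0 = 1.
Proof. by rewrite /stanley_h /h_step eqxx. Qed.

Lemma stanley_hE P : P != set0 ->
  stanley_h P = \sum_(F \in [set F | proper_face F P])
     stanley_g F * ('X - 1) ^+ absz (set_dim P - 1 - set_dim F)%R.
Proof. by rewrite /stanley_h /h_step => /negbTE ->. Qed.

Lemma stanley_gE P : P != set0 ->
  stanley_g P = ((stanley_h P)`_0)%:P +
    \sum_(1 <= i < (absz (set_dim P))./2.+1)
       ((stanley_h P)`_i - (stanley_h P)`_i.-1) *: 'X^i.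
Proof.
move=> Pn0; have := set_dim_ge0 Pn0; rewrite {1}/stanley_g.
case Ed: (set_dim P) => [d|//] _; rewrite -PoszD absz_nat addn1 /=.
have -> : stanley_h P = h_step (stanley_g_rec d) P.
  apply: eq_h_step => F /proper_face_dim; rewrite Ed => Fd.
  by apply: stanley_g_rec_stable; have := set_dim_geN1 F; lia.
by rewrite /g_step (negbTE Pn0) Ed absz_nat.
Qed.

End Polytopes.

Section Graphs.
Variables (k : nat) (r : 'I_k -> 'I_k -> nat).

(* The l-th edge from i to j, with i != j and l < r i j; r i i is irrelevant. *)
Definition edge : Type :=
  {p : {ij : 'I_k * 'I_k | ij.1 != ij.2} & 'I_(r (val p).1 (val p).2)}.

HB.instance Definition _ := Finite.on edge.

Definition src (e : edge) : 'I_k := (val (tag e)).1.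
Definition tgt (e : edge) : 'I_k := (val (tag e)).2.

(* A subgraph on the full vertex set is given by its set of edges. *)
Implicit Types G : {set edge}.

Definition adj G : rel 'I_k :=
  [rel i j | [exists e in G, (src e == i) && (tgt e == j)]].

(* There are no loops, so a cycle has length at least 2; length 2 is allowed. *)
Definition has_dicycle G : Prop :=
  exists s : seq 'I_k, s != [::] /\ ucycle (adj G) s.

Definition rooted_at (v : 'I_k) G : Prop := forall u, connect (adj G) u v.

End Graphs.

Section RootPolytope.
Variables (R : realType) (k : nat) (r : 'I_k -> 'I_k -> nat).

Definition alpha (e : edge r) : 'rV[R]_k :=
  delta_mx 0 (src e) - delta_mx 0 (tgt e).

Definition root_comb (m : {ffun edge r -> R^o}) : 'rV[R]_k :=
  \sum_e (m e : R) *: alpha e.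

Fact root_comb_is_linear : linear root_comb.
Proof.
move=> a u v; rewrite /root_comb scaler_sumr -big_split /=.
by apply: eq_bigr => e _; rewrite !ffunE scalerA -scalerDl.
Qed.

HB.instance Definition _ :=
  GRing.isLinear.Build R _ _ _ root_comb root_comb_is_linear.

(* This is t^*, the space of linear relations between the roots; its dual t is
   gale_dual_space. *)
Definition root_relations : {vspace {ffun edge r -> R^o}} :=
  lker (linfun root_comb).

Lemma root_relationsP (m : {ffun edge r -> R^o}) :
  reflect (\sum_e (m e : R) *: alpha e = 0) (m \in root_relations).
Proof. by rewrite memv_ker lfunE; exact: eqP. Qed.

Definition gale_dual_space : vectType R := 'Hom(subvs_of root_relations, R^o).

Definition root_coord (e : edge r) (m : subvs_of root_relations) : R^o :=
  vsval m e.

Fact root_coord_is_linear e : linear (root_coord e).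
Proof. by move=> a u v; rewrite /root_coord linearP !ffunE. Qed.

HB.instance Definition _ e :=
  GRing.isLinear.Build R _ _ _ (root_coord e) (root_coord_is_linear e).

Definition gale_dual (e : edge r) : gale_dual_space := linfun (root_coord e).

Lemma gale_dualE e m : gale_dual e m = vsval m e.
Proof. by rewrite lfunE. Qed.

Definition gale_root_polytope : set gale_dual_space := conv_hull gale_dual.

End RootPolytope.

Arguments root_relations R {k} r.
Arguments gale_dual_space R {k} r.
Arguments gale_dual R {k r} e.
Arguments gale_root_polytope R {k} r.

(* Main.v *)
Require Import Defs.
From HB Require Import structures.
From mathcomp Require Import classical_sets functions fsbigop.
From mathcomp Require Import all_boot all_order all_algebra.
From mathcomp Require Import boolp reals.
From mathcomp Require Import zify ring lra.

(* By Gale duality the faces of the polytope are the hulls F_H of the beta_e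
   with e outside H, where H runs over the totally cyclic edge sets (every edge
   on a directed cycle), because these are the supports of the nonnegative
   circulations; moreover dim F_H = n - |H| - c(H), with c(H) the number of
   components of H.  By induction on faces,
     g(F_H, t) = sum over rooted G with cyclic part H of (t-1)^(|G|-|H|-c(H)+1):
   a rooted graph with a cycle is the union of its cyclic part H and of a graph
   that is acyclic after contracting H, so the recursion for h gives the same
   kind of sum over the rooted G with cyclic part larger than H, which for H
   empty is the theorem.  To pass from h to g one must see that the sum of
   (t-1)^(|G|-|H|-c(H)+1) over all rooted G containing H has no terms of degree
   at most dim(F_H)/2.  Expand it in the (t-1)^|X| t^(m-|X|), where X lies in
   the complement of H, of size m: the coefficient of X is an alternating count
   of rooted subgraphs, and vanishes as soon as some edge of X lies on a cycle
   of H + X.  Since r_ij = r_ji, edges can be reversed, and this happens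
   whenever 2|X| > m. *)

Set Implicit Arguments.
Unset Strict Implicit.
Unset Printing Implicit Defensive.

Import Order.TTheory GRing.Theory Num.Theory.
Local Open Scope ring_scope.

(** * Directed cycles and reachability *)

Section SubsetSums.
Variable E : finType.

Lemma big_subsetD1 (V : nmodType) (M : {set E}) (e : E) (F : {set E} -> V) :
  e \in M ->
  \sum_(Y : {set E} | Y \subset M) F Y =
  \sum_(Y : {set E} | Y \subset M :\ e) (F Y + F (e |: Y)).
Proof.
move=> eM; rewrite big_split /= (bigID (fun Y : {set E} => e \notin Y)) /=.
congr (_ + _); first by apply: eq_bigl => Y; rewrite subsetD1.
rewrite (reindex_onto (fun Y => e |: Y) (fun Y => Y :\ e)) /=; last first.
  by move=> Y /andP[_]; rewrite negbK => /setD1K.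
apply: eq_bigl => Y; rewrite negbK setU11 andbT subUset sub1set eM /= subsetD1.
apply: andb_id2l => YM; apply/eqP/idP => [<-|eY]; first by rewrite setD11.
exact: setU1K.
Qed.

(* Moebius inversion over the Boolean lattice: writing [f] as the sum of its
   inverse turns the left side into a combination of [(X-1)^|Z| X^(|M|-|Z|)]. *)
Lemma sum_expX1 (f : {set E} -> {poly int}) (M : {set E}) :
  \sum_(Y : {set E} | Y \subset M) f Y * ('X - 1) ^+ #|Y| =
  \sum_(Z : {set E} | Z \subset M)
    ('X - 1) ^+ #|Z| * 'X ^+ (#|M| - #|Z|) * (-1) ^+ #|Z| *
    \sum_(Y : {set E} | Y \subset Z) (-1) ^+ #|Y| * f Y.
Proof.
have [m] := ubnP #|M|; elim: m => // m IHm in M f *; rewrite ltnS => Mm.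
have [->|[e eM]] := set_0Vmem M.
  have sub0 (A : {set E}) : (A \subset set0) = (A == set0).
    by rewrite subset0.
  rewrite !(eq_bigl _ _ sub0) !big_pred1_eq (eq_bigl _ _ sub0) big_pred1_eq.
  by rewrite cards0 !expr0 !mul1r mulr1.
have cM : #|M| = #|M :\ e|.+1 by rewrite (cardsD1 e) eM.
have cMe (Y : {set E}) : Y \subset M :\ e -> #|e |: Y| = #|Y|.+1.
  by rewrite subsetD1 => /andP[_ eY]; rewrite cardsU1 eY.
rewrite [LHS](big_subsetD1 _ eM) [RHS](big_subsetD1 _ eM).
(* Pairing [Y] with [e |: Y] leaves a sum of the same shape over [M :\ e], for the function
   [f Y + ('X - 1) * f (e |: Y)]. *)
have eqL : \sum_(Y : {set E} | Y \subset M :\ e)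
     (f Y * ('X - 1) ^+ #|Y| + f (e |: Y) * ('X - 1) ^+ #|e |: Y|) =
   \sum_(Y : {set E} | Y \subset M :\ e)
     (f Y + ('X - 1) * f (e |: Y)) * ('X - 1) ^+ #|Y|.
  by apply: eq_bigr => Y YM; rewrite cMe // exprS; ring.
rewrite {}eqL IHm; last by rewrite -ltnS -cM.
apply: eq_bigr => Z ZM.
have eZ : e \notin Z by move: ZM; rewrite subsetD1 => /andP[].
have le_ZM : (#|Z| <= #|M :\ e|)%N by exact: subset_leq_card.
rewrite (big_subsetD1 _ (setU11 e Z)) (setU1K eZ) (cMe Z ZM) cM subSS.
rewrite (subSn le_ZM).
set S1 := \sum_(Y : {set E} | Y \subset Z) (-1) ^+ #|Y| * f Y.
pose S2 : {poly int} :=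
  \sum_(Y : {set E} | Y \subset Z) (-1) ^+ #|Y| * f (e |: Y).
have -> : \sum_(Y : {set E} | Y \subset Z)
    (-1) ^+ #|Y| * (f Y + ('X - 1) * f (e |: Y)) = S1 + ('X - 1) * S2.
  rewrite mulr_sumr -big_split /=; apply: eq_bigr => Y _; ring.
have -> : \sum_(Y : {set E} | Y \subset Z)
    ((-1) ^+ #|Y| * f Y + (-1) ^+ #|e |: Y| * f (e |: Y)) = S1 - S2.
  rewrite -sumrB; apply: eq_bigr => Y YZ.
  by rewrite cMe ?(subset_trans YZ) // exprS; ring.
(* What remains is ['X * S1 - ('X - 1) * (S1 - S2) = S1 + ('X - 1) * S2]. *)
by rewrite !exprS; ring.
Qed.

End SubsetSums.

Section Digraphs.
Variables (k : nat) (r : 'I_k -> 'I_k -> nat).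
Implicit Types (G H X Y : {set edge r}) (e : edge r) (T : {set 'I_k}).

Lemma adj_edge G e : e \in G -> adj G (src e) (tgt e).
Proof. by move=> eG; apply/existsP; exists e; rewrite eG !eqxx. Qed.

Lemma adjP G u w :
  reflect (exists2 e, e \in G & src e = u /\ tgt e = w) (adj G u w).
Proof.
apply: (iffP existsP) => [[e /and3P[eG /eqP su /eqP tw]]|[e eG [<- <-]]].
  by exists e.
by exists e; rewrite eG !eqxx.
Qed.

Lemma connect_edge G e : e \in G -> connect (adj G) (src e) (tgt e).
Proof. by move=> /adj_edge /connect1. Qed.

Lemma connect_adjS G H u w :
  G \subset H -> connect (adj G) u w -> connect (adj H) u w.
Proof.
move=> /subsetP GH; apply: connect_sub => x y /adjP[e eG [<- <-]].
exact: connect_edge (GH _ eG).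
Qed.

Lemma connect_adj_ind G (P : 'I_k -> 'I_k -> Prop) :
  (forall u, P u u) ->
  (forall e w, e \in G -> connect (adj G) (tgt e) w -> P (tgt e) w ->
     P (src e) w) ->
  forall u w, connect (adj G) u w -> P u w.
Proof.
move=> P0 PS u w /connectP[p]; elim: p u => [|x p IHp] u /=; first by move=> _ ->.
move=> /andP[/adjP[e eG [<- <-]] pth] lw; apply: PS => //; last exact: IHp.
by apply/connectP; exists p.
Qed.

(** These are the edges on directed cycles; the fixed points of [cyclic_part] are the totally cyclic
    edge sets. *)
Definition cyclic_part G := [set e in G | connect (adj G) (tgt e) (src e)]%SET.

Lemma cyclic_partS G H : G \subset H -> cyclic_part G \subset cyclic_part H.
Proof.
move=> GH; apply/subsetP => e; rewrite !inE => /andP[eG c].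
by rewrite (subsetP GH) // (connect_adjS GH).
Qed.

Lemma cyclic_part_sub G : cyclic_part G \subset G.
Proof. by apply/subsetP => e; rewrite inE => /andP[]. Qed.

(** The way back from [w] to [u] closes every edge of the path into a cycle. *)
Lemma connect_cyclic_part G u w :
  connect (adj G) u w -> connect (adj G) w u -> connect (adj (cyclic_part G)) u w.
Proof.
move: u w; apply: connect_adj_ind => [//|e w eG tw IH wt].
apply: connect_trans (IH _); last exact: connect_trans wt (connect_edge eG).
by apply: connect_edge; rewrite inE eG (connect_trans tw).
Qed.

Lemma cyclic_part_id G : cyclic_part (cyclic_part G) = cyclic_part G.
Proof.
apply/eqP; rewrite eqEsubset cyclic_part_sub; apply/subsetP => e eC.
have /andP[eG c] : (e \in G) && connect (adj G) (tgt e) (src e) by rewrite inE in eC.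
by rewrite in_set eC connect_cyclic_part // connect_edge.
Qed.

Lemma cyclic_part_max G H :
  H \subset G -> cyclic_part H = H -> H \subset cyclic_part G.
Proof. by move=> HG {1}<-; exact: cyclic_partS. Qed.

(** Each edge can be undone by following the rest of a cycle through it. *)
Lemma connect_cyclic_sym H : cyclic_part H = H -> connect_sym (adj H).
Proof.
move=> HH; suff sub u w : connect (adj H) u w -> connect (adj H) w u.
  by move=> u w; apply/idP/idP; exact: sub.
move: u w; apply: connect_adj_ind => [//|e w eH _ IH].
apply: connect_trans IH _.
by move: eH; rewrite -{1}HH inE => /andP[].
Qed.

Lemma has_dicycleP G : has_dicycle G <-> cyclic_part G != set0.
Proof.
split=> [[s [s0 /andP[cyc _]]]|/set0Pn[e]].
  case: s s0 cyc => // x s _ cyc.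
  have cc y z : y \in x :: s -> z \in x :: s -> connect (adj G) y z.
    by move=> ys zs; exact: connect_cycle cyc y z ys zs.
  have := cyc; case: s cc cyc => [|y s] cc cyc /= /andP[/adjP[e eG [se te]] _];
    apply/set0Pn; exists e; rewrite inE eG; apply: cc;
    by rewrite ?te ?se !inE eqxx ?orbT.
rewrite inE => /andP[eG /connectP[p pth se]].
(* [ucycle] asks for distinct vertices, so the return path is made simple. *)
case/shortenP: pth se => q qth qu _ se.
exists (tgt e :: q); split=> //; rewrite /ucycle qu andbT /= rcons_path qth /=.
by rewrite -se adj_edge.
Qed.

(** Rootedness with a set of roots, so that edges can be contracted into the root. *)
Definition reaches T G := [forall u, [exists w in T, connect (adj G) u w]].

Lemma reachesP T G :
  reflect (forall u, exists2 w, w \in T & connect (adj G) u w) (reaches T G).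
Proof.
apply: (iffP forallP) => RT u.
  by have /existsP[w /andP[]] := RT u; exists w.
by have [w wT c] := RT u; apply/existsP; exists w; rewrite wT.
Qed.

Lemma reaches_rooted_at v G : reaches [set v]%SET G <-> rooted_at v G.
Proof.
split=> [/reachesP RT u|RT]; first by have [w /set1P->] := RT u.
by apply/reachesP => u; exists v; rewrite ?inE.
Qed.

Definition edge_closed T H := forall e, e \in H -> (src e \in T) = (tgt e \in T).

Lemma edge_closed_connect T G u w :
  (forall e, e \in G -> src e \in T -> tgt e \in T) ->
  connect (adj G) u w -> u \in T -> w \in T.
Proof.
move=> cT; move: u w; apply: connect_adj_ind => // e w eG _ IH /(cT _ eG).
exact: IH.
Qed.

(** Up to sign, the coefficient of the product of all edges of [X] in the multilinear reliability
    polynomial, the edges of [H] being always present. *)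
Definition reach_sum T H X : int :=
  \sum_(Y : {set edge r} | Y \subset X) (-1) ^+ #|Y| * (reaches T (H :|: Y))%:R.

Lemma reach_sumD1 T H X e : e \in X ->
  reach_sum T H X =
  reach_sum T H (X :\ e) -
  \sum_(Y : {set edge r} | Y \subset X :\ e)
     (-1) ^+ #|Y| * (reaches T (H :|: Y :|: [set e]))%:R.
Proof.
move=> eX; rewrite /reach_sum (big_subsetD1 _ eX) big_split /= -sumrN.
congr (_ + _); apply: eq_bigr => Y; rewrite subsetD1 => /andP[_ eY].
rewrite cardsU1 eY exprS mulN1r mulNr.
by rewrite (setUC [set e]%SET) setUA.
Qed.

(** A path that uses [e] may as well stop at its source. *)
Lemma reaches_src T G e : src e \in T -> reaches T (G :|: [set e]) = reaches T G.
Proof.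
move=> sT; apply/reachesP/reachesP => RT u; last first.
  have [w wT c] := RT u; exists w => //; apply: connect_adjS c; exact: subsetUl.
have [w] := RT u; move=> wT c; move: u w c wT; apply: connect_adj_ind.
  by move=> u uT; exists u.
move=> f w; rewrite !inE => /orP[fG|/eqP->] _ IH wT; last by exists (src e).
have [w' w'T c] := IH wT; exists w' => //.
exact: connect_trans (connect_edge fG) c.
Qed.

(** An edge into [T] turns its source into a further root; all that reaches this source inside [H]
    is added too, so that [edge_closed] is preserved when [H] is totally cyclic. *)
Lemma reaches_tgt T H G e : H \subset G -> tgt e \in T ->
  reaches T (G :|: [set e]) =
  reaches (T :|: [set w | connect (adj H) w (src e)])%SET G.
Proof.
move=> HG tT; apply/reachesP/reachesP => RT u; last first.
  have GG : G \subset G :|: [set e]%SET by exact: subsetUl.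
  have [w] := RT u; rewrite !inE => /orP[wT c|c' c].
    by exists w => //; exact: connect_adjS c.
  exists (tgt e) => //; apply: connect_trans (connect_adjS GG c) _.
  apply: connect_trans (connect_adjS (subset_trans HG GG) c') _.
  by apply: connect_edge; rewrite !inE eqxx orbT.
have [w] := RT u; move=> wT c; move: u w c wT; apply: connect_adj_ind.
  by move=> u uT; exists u; rewrite // inE uT.
move=> f w; rewrite !inE => /orP[fG|/eqP->] _ IH wT; last first.
  by exists (src e); rewrite // !inE connect0 orbT.
have [w' w'T c] := IH wT; exists w' => //.
exact: connect_trans (connect_edge fG) c.
Qed.

(* The vanishing half of the Satyanarayana-Prabhakar domination theorem, with
   the strong components of [H] contracted and [T] merged into the root. *)
Lemma reach_sum_eq0 T H X e :
  cyclic_part H = H -> edge_closed T H ->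
  e \in X -> connect (adj (H :|: X)) (tgt e) (src e) ->
  reach_sum T H X = 0.
Proof.
move=> HH; have [m] := ubnP #|X|; elim: m => // m IHm in X T e *.
rewrite ltnS => Xm cT eX ce.
have [[f fX sf]|nosrc] :
    (exists2 f, f \in X & src f \in T) \/ (forall f, f \in X -> src f \notin T).
  case: (pickP [pred f in X | src f \in T]) => /= [f /andP[fX sf]|no].
    by left; exists f.
  by right=> f fX; have := no f; rewrite /= fX /= => ->.
  (* An edge starting in [T] never matters, so the terms with and without it cancel. *)
  rewrite (reach_sumD1 _ _ fX); apply/eqP; rewrite subr_eq0; apply/eqP.
  by apply: eq_bigr => Y _; rewrite reaches_src.
have fwd f : f \in H :|: X -> src f \in T -> tgt f \in T.
  by rewrite inE => /orP[/cT->|/nosrc/negbTE->].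
(* If no edge of [X] enters [T] either, then [src e] cannot reach [T] and every term is zero. *)
case: (pickP [pred f in X | tgt f \in T]) => /= [f /andP[fX tf]|no]; last first.
  apply: big1 => Y YX; suff -> : reaches T (H :|: Y) = false by rewrite mulr0.
  apply/negbTE/reachesP => /(_ (src e))[w wT c].
  have := @edge_closed_connect (~: T) (H :|: Y) (src e) w.
  rewrite !inE wT (nosrc _ eX); suff P h : h \in H :|: Y ->
      src h \in ~: T -> tgt h \in ~: T by move=> /(_ P c isT).
  rewrite !inE => /orP[/cT->//|hY] _; have := no h.
  by rewrite /= (subsetP YX _ hY) /= => ->.
have srcT : src e \notin T := nosrc _ eX.
(* No path leaves [T], so a path ending outside [T] avoids [f]: the cycle through [e] survives when
   [f] is deleted or contracted into the root. *)
have te u w : connect (adj (H :|: X)) u w -> w \notin T ->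
    connect (adj (H :|: (X :\ f))) u w.
  move: u w; apply: connect_adj_ind => // h w hHX c IH wT.
  apply: connect_trans (IH wT); apply: connect_edge.
  move: (hHX); rewrite !inE; case: (eqVneq h f) => //= hf _.
  by rewrite (edge_closed_connect fwd c _) // hf in wT.
have ef : e \in X :\ f.
  rewrite !inE eX andbT; apply/negP => /eqP ef.
  by rewrite (edge_closed_connect fwd ce) // ef in srcT.
have cXf : (#|X :\ f| < m)%N by move: Xm; rewrite (cardsD1 f X) fX.
rewrite (reach_sumD1 _ _ fX).
have -> : \sum_(Y : {set edge r} | Y \subset X :\ f)
     (-1) ^+ #|Y| * (reaches T (H :|: Y :|: [set f]))%:R =
     reach_sum (T :|: [set w | connect (adj H) w (src f)]) H (X :\ f).
  apply: eq_bigr => Y _; rewrite -reaches_tgt //; exact: subsetUl.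
rewrite !(IHm _ _ e) ?subr0 ?te //.
move=> h hH; rewrite !inE (cT _ hH); congr (_ || _).
by apply: same_connect; [exact: connect_cyclic_sym|exact: connect_edge].
Qed.

End Digraphs.

(** * Spans and kernels of functionals *)

Section Functionals.
Variables (K : fieldType) (V : vectType K).
Implicit Types (f : 'Hom(V, K^o)) (fs : seq 'Hom(V, K^o)) (U : {vspace V}).

Lemma memv_bigcap_lker fs x :
  (x \in \bigcap_(f <- fs) lker f)%VS = all (fun f => f x == 0) fs.
Proof.
elim: fs => [|f fs IHfs]; first by rewrite big_nil memvf.
by rewrite big_cons memv_cap IHfs memv_ker.
Qed.

(** [f] kills the kernel of the joint map [Psi] of all of [fs], hence factors through it; the
    coefficients are the values of the factor [g] on unit vectors. *)
Lemma memv_span_functional f fs :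
  (\bigcap_(g <- fs) lker g <= lker f)%VS -> (f \in <<fs>>)%VS.
Proof.
move=> fsf; pose n := size fs.
pose Psi0 (x : V) : 'rV[K]_n := \row_(i < n) (fs`_i x : K).
have Psi_lin : linear Psi0.
  by move=> a x y; apply/rowP => i; rewrite !mxE linearP.
pose PsiM := GRing.isLinear.Build _ _ _ _ Psi0 Psi_lin.
pose PsiL : {linear V -> 'rV[K]_n} := HB.pack Psi0 PsiM.
pose Psi := linfun PsiL; pose g := (f \o Psi^-1)%VF.
have fE x : f x = g (Psi x).
  rewrite comp_lfunE; apply/eqP; rewrite -subr_eq0 -linearB -memv_ker.
  apply: subvP fsf _ _; rewrite memv_bigcap_lker; apply/(all_nthP 0) => i ifs.
  have : Psi (x - (Psi^-1)%VF (Psi x)) = 0.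
    rewrite linearB /= -[X in _ - X]comp_lfunE -[X in _ - X]comp_lfunE.
    by rewrite inv_lfun_def subrr.
  by rewrite lfunE /= => /rowP/(_ (Ordinal ifs)); rewrite !mxE /= => ->.
have -> : f = \sum_(i < n) (g (delta_mx 0 i) : K) *: fs`_i.
  apply/lfunP => x; rewrite fE sum_lfunE [Psi x]row_sum_delta linear_sum /=.
  apply: eq_bigr => i _; rewrite linearZ /= scale_lfunE lfunE /= mxE.
  by rewrite /GRing.scale /= mulrC.
apply: rpred_sum => i _; apply: rpredZ; exact/memv_span/mem_nth.
Qed.

Lemma subv_lker_span f fs :
  (f \in <<fs>>)%VS -> (\bigcap_(g <- fs) lker g <= lker f)%VS.
Proof.
move=> ffs; apply/subvP => x; rewrite memv_bigcap_lker memv_ker => /allP fx0.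
rewrite (coord_span (X := in_tuple fs) ffs) sum_lfunE; apply/eqP.
apply: big1 => i _; rewrite scale_lfunE (eqP (fx0 _ (mem_nth _ _))) ?scaler0 //.
Qed.

(** Each functional independent of the others cuts the common kernel down by exactly one
    dimension. *)
Lemma dim_span_functionals fs :
  (\dim <<fs>> + \dim (\bigcap_(f <- fs) lker f))%N = \dim {:V}.
Proof.
elim: fs => [|f fs IHfs]; first by rewrite span_nil dimv0 big_nil.
rewrite span_cons big_cons -IHfs.
have [ffs|ffs] := boolP (f \in <<fs>>)%VS.
  rewrite (capv_idPr (subv_lker_span ffs)).
  by have /addv_idPr-> : (<[f]> <= <<fs>>)%VS by rewrite -memvE.
have f0 : f != 0 by apply: contraNneq ffs => ->; rewrite mem0v.
set W := (\bigcap_(g <- fs) lker g)%VS.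
have Wf : ~~ (W <= lker f)%VS by apply: contraNN ffs => /memv_span_functional.
rewrite dimv_disjoint_sum; last first.
  apply/eqP; rewrite -subv0; apply/subvP => y; rewrite memv_cap => /andP[].
  move=> /vlineP[a ->] afs; have [->|a0] := eqVneq a 0; first by rewrite scale0r mem0v.
  by rewrite rpredZeq (negbTE a0) (negbTE ffs) in afs.
rewrite dim_vline f0 -[X in _ = (_ + X)%N](limg_ker_dim f W) (capvC W).
have -> : \dim (f @: W) = 1%N; last by lia.
apply/eqP; rewrite eqn_leq; apply/andP; split.
  by apply: leq_trans (dimvS (subvf _)) _; rewrite dimvf.
by rewrite lt0n dimv_eq0 -lkerE.
Qed.

Lemma dimv_lker_lt f x U : (U <= lker f)%VS -> f x != 0 -> (\dim U < \dim {:V})%N.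
Proof.
move=> Uf fx; rewrite ltn_neqAle dimvS ?subvf // andbT.
apply: contraNneq fx => eqd.
have /eqP UV : (U == fullv) by rewrite eqEdim subvf eqd leqnn.
by rewrite -memv_ker; apply: subvP Uf _ _; rewrite UV memvf.
Qed.

End Functionals.

(** * Rank of the root configuration *)

Section RootRank.
Variables (R : realType) (k : nat) (r : 'I_k -> 'I_k -> nat).
Notation E := (edge r).
Implicit Types (G H : {set E}) (e : E) (v : 'I_k).

Definition potential_fun (p : 'I_k -> R) (x : 'rV[R]_k) : R^o :=
  \sum_i x 0 i * p i.

Fact potential_fun_linear p : linear (potential_fun p).
Proof.
move=> a x y; rewrite /potential_fun /GRing.scale /= mulr_sumr -big_split /=.
by apply: eq_bigr => i _; rewrite !mxE; ring.
Qed.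

HB.instance Definition _ p :=
  GRing.isLinear.Build R _ _ _ (potential_fun p) (potential_fun_linear p).

Definition potential p : 'Hom('rV[R]_k, R^o) := linfun (potential_fun p).

Lemma potential_delta p v : potential p (delta_mx 0 v) = p v.
Proof.
rewrite lfunE /= /potential_fun (bigD1 v) //= mxE !eqxx mul1r big1 ?addr0 //.
by move=> i iv; rewrite mxE (negbTE iv) andbF mul0r.
Qed.

Lemma potential_alpha p e : potential p (alpha R e) = p (src e) - p (tgt e).
Proof. by rewrite linearB /= !potential_delta. Qed.

Definition root_span G : {vspace 'rV[R]_k} := <<[seq alpha R e | e in G]>>%VS.

(** The graphic matroid rank: [k] minus the number of connected components. *)
Definition root_rank G : nat := \dim (root_span G).

Lemma memv_root_span G e : e \in G -> alpha R e \in root_span G.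
Proof. by move=> eG; apply/memv_span/image_f. Qed.

Lemma root_span_subP G (U : {vspace 'rV[R]_k}) :
  (forall e, e \in G -> alpha R e \in U) -> (root_span G <= U)%VS.
Proof. by move=> GU; apply/span_subvP => _ /imageP[e eG ->]; exact: GU. Qed.

(** All roots lie in the hyperplane of coordinate sum zero; [v] witnesses that it is proper. *)
Lemma root_rank_lt v G : (root_rank G < k)%N.
Proof.
have := @dimv_lker_lt R _ (potential (fun=> 1)) (delta_mx 0 v) (root_span G).
rewrite dimvf dim_matrix mul1r; apply.
  by apply: root_span_subP => e _; rewrite memv_ker potential_alpha subrr.
by rewrite potential_delta oner_eq0.
Qed.

(** Roots telescope along paths to [v], so adding the unit vector at [v] to the span gives the whole
    space. *)
Lemma root_rank_rooted v G : reaches [set v] G -> root_rank G = k.-1.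
Proof.
move=> Gv; have := root_rank_lt v G; suff : (k <= root_rank G + 1)%N by lia.
have step u w : connect (adj G) u w -> delta_mx 0 u - delta_mx 0 w \in root_span G.
  move: u w; apply: connect_adj_ind => [u|e w eG _ IH]; first by rewrite subrr mem0v.
  rewrite -[X in X - _](subrK (delta_mx 0 (tgt e))) -addrA rpredD //.
  exact: memv_root_span.
pose dv : 'rV[R]_k := delta_mx 0 v.
have full : (fullv <= root_span G + <[dv]>)%VS.
  apply/subvP => x _; rewrite [x]row_sum_delta; apply: rpred_sum => u _.
  apply: rpredZ; rewrite -[X in X \in _](subrK dv).
  apply: memv_add; last exact: memv_line.
  by have /reachesP/(_ u)[w /set1P-> /step] := Gv.
have := dimvS full; rewrite dimvf dim_matrix mul1r => /leq_trans; apply.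
by apply: leq_trans (dimv_add_leqif _ _) _; rewrite leq_add2l dim_vline leq_b1.
Qed.

Lemma root_rank_leD G H :
  H \subset G -> (root_rank G <= root_rank H + (#|G| - #|H|))%N.
Proof.
move=> HG; rewrite -(eqP (_ : #|G :\: H| == #|G| - #|H|)%N); last first.
  by rewrite cardsDS.
have sub : (root_span G <= root_span H + root_span (G :\: H))%VS.
  apply: root_span_subP => e eG; have [eH|eH] := boolP (e \in H).
    by apply: subvP (addvSl _ _) _ _; exact: memv_root_span.
  by apply: subvP (addvSr _ _) _ _; apply: memv_root_span; rewrite inE eH.
apply: leq_trans (dimvS sub) _; apply: leq_trans (dimv_add_leqif _ _) _.
by rewrite leq_add2l; apply: leq_trans (dim_span _) _; rewrite size_image.
Qed.

(* An edge outside every cycle is separated by a vertex set closed under [H]. *)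
Lemma root_rank_ltS v G H :
  cyclic_part H = H -> cyclic_part G = H -> H \proper G ->
  (root_rank H + 1 < k)%N.
Proof.
move=> HH GH /properP[HG [e eG eH]].
suff : (root_rank H < root_rank G)%N by have := root_rank_lt v G; lia.
have sub : (root_span H <= root_span G)%VS.
  by apply: root_span_subP => f fH; apply/memv_root_span/(subsetP HG).
rewrite ltn_neqAle dimvS // andbT; apply/negP => /eqP eqd.
have /eqP HGs : root_span H == root_span G.
  by rewrite eqEdim sub -/(root_rank G) -eqd leqnn.
pose U := [set w | connect (adj H) (tgt e) w].
have : (root_span H <= lker (potential (fun w => (w \in U)%:R)))%VS.
  apply: root_span_subP => f fH; rewrite memv_ker potential_alpha !inE.
  rewrite (same_connect_r (connect_cyclic_sym HH) (connect_edge fH)).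
  by rewrite subrr.
rewrite HGs => /subvP/(_ _ (memv_root_span eG)).
rewrite memv_ker potential_alpha !inE connect0.
suff -> : connect (adj H) (tgt e) (src e) = false by rewrite sub0r oppr_eq0 oner_eq0.
apply: contraNF eH => c; rewrite -GH inE eG; exact: connect_adjS c.
Qed.

Definition edge_delta e : {ffun E -> R^o} := [ffun f => (f == e)%:R : R].

Lemma ffun_sum_delta (m : {ffun E -> R^o}) : m = \sum_e (m e : R) *: edge_delta e.
Proof.
apply/ffunP => f; rewrite sum_ffunE (bigD1 f) //= big1 => [|e ef]; rewrite !ffunE.
  by rewrite eqxx addr0 /GRing.scale /= mulr1.
by rewrite eq_sym (negbTE ef) /GRing.scale /= mulr0.
Qed.

Definition supported G : {vspace {ffun E -> R^o}} :=
  <<[seq edge_delta e | e in G]>>%VS.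

Lemma supportedP G (m : {ffun E -> R^o}) :
  reflect (forall e, e \notin G -> m e = 0) (m \in supported G).
Proof.
apply: (iffP idP) => [mG e eG|mG].
  have coord_lin : linear (fun m : {ffun E -> R^o} => m e).
    by move=> a x y; rewrite !ffunE.
  pose cM := GRing.isLinear.Build _ _ _ _ _ coord_lin.
  pose cL : {linear {ffun E -> R^o} -> R^o} :=
    HB.pack (fun m : {ffun E -> R^o} => m e) cM.
  have sub : (supported G <= lker (linfun cL))%VS.
    apply/span_subvP => _ /imageP[f fG ->]; rewrite memv_ker lfunE /= ffunE.
    by have [ef|_] := eqVneq e f; rewrite ?eqxx // ef fG in eG *.
  by have := subvP sub _ mG; rewrite memv_ker lfunE => /eqP.
rewrite [m]ffun_sum_delta; apply: rpred_sum => e _.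
have [eG|eG] := boolP (e \in G); last by rewrite mG // scale0r mem0v.
by apply: rpredZ; apply/memv_span/image_f.
Qed.

(** The spaces of [G] and of its complement are bounded by their numbers of generators and together
    span everything, so both bounds are attained. *)
Lemma dim_supported G : \dim (supported G) = #|G|.
Proof.
have le H : (\dim (supported H) <= #|H|)%N.
  by apply: leq_trans (dim_span _) _; rewrite size_image.
have : (#|G| + #|~: G| <= \dim (supported G) + \dim (supported (~: G)))%N.
  have -> : (#|G| + #|~: G|)%N = \dim {: {ffun E -> R^o}}.
    by rewrite cardsC dimvf /dim /= muln1.
  apply: leq_trans (dimv_add_leqif _ _); apply: dimvS.
  apply/subvP => m _; rewrite [m]ffun_sum_delta; apply: rpred_sum => e _.
  apply: rpredZ; have [eG|eG] := boolP (e \in G).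
    by apply: subvP (addvSl _ _) _ _; apply/memv_span/image_f.
  by apply: subvP (addvSr _ _) _ _; apply/memv_span/image_f; rewrite inE.
by have := le G; have := le (~: G); lia.
Qed.

Lemma root_comb_delta e : root_comb (edge_delta e) = alpha R e.
Proof.
rewrite /root_comb (bigD1 e) //= ffunE eqxx scale1r big1 ?addr0 // => f fe.
by rewrite ffunE (negbTE fe) scale0r.
Qed.

(** Rank-nullity for [root_comb] on the functions supported on [G]. *)
Lemma dim_relations_supported G :
  (\dim (root_relations R r :&: supported G) + root_rank G)%N = #|G|.
Proof.
rewrite -[RHS]dim_supported -[RHS](limg_ker_dim (linfun (@root_comb R k r))).
rewrite /root_relations /root_rank /supported capvC limg_span.
congr (_ + \dim _)%N; congr (<<_>>)%VS.
rewrite -map_comp; apply: eq_map => e.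
by rewrite /= lfunE /= root_comb_delta.
Qed.

Definition gale_span G : {vspace gale_dual_space R r} :=
  <<[seq gale_dual R e | e in ~: G]>>%VS.

(** The rank formula of the dual matroid: the relations killed by [gale_dual e] for all [e] outside
    [G] are those supported on [G]. *)
Lemma dim_gale_span v G : reaches [set v] [set: E] ->
  (\dim (gale_span G) + k.-1 + #|G| = #|{: E}| + root_rank G)%N.
Proof.
move=> Ev.
have := dim_span_functionals [seq gale_dual R e | e in ~: G].
rewrite -/(gale_span G).
have := dim_relations_supported [set: E].
rewrite (root_rank_rooted Ev) cardsT.
have -> : supported setT = fullv.
  apply/eqP; rewrite eqEsubv subvf; apply/subvP => m _; apply/supportedP => e.
  by rewrite inE.
rewrite capvf [\dim {:_}]dimvf /dim /= => dimR.
set K := (\bigcap_(f <- _) _)%VS.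
have -> : \dim K = \dim (root_relations R r :&: supported G).
  pose inj := linfun (vsval : subvs_of (root_relations R r) -> _).
  have inj0 : lker inj == 0%VS.
    by apply/lker0P => x y; rewrite !lfunE /=; exact: val_inj.
  rewrite -(limg_dim_eq (f := inj) (U := K)); last by rewrite (eqP inj0) capv0.
  congr (\dim _); apply/vspaceP => m; apply/idP/idP.
    case/memv_imgP => x xK ->; rewrite lfunE /= memv_cap subvsP /=.
    apply/supportedP => e eG; rewrite memv_bigcap_lker in xK.
    have /(allP xK)/eqP : gale_dual R e \in [seq gale_dual R e | e in ~: G].
      by apply: image_f; rewrite inE.
    by rewrite gale_dualE.
  rewrite memv_cap => /andP[mR /supportedP mG].
  apply/memv_imgP; exists (vsproj _ m); last by rewrite lfunE /= vsprojK.
  rewrite memv_bigcap_lker; apply/allP => _ /imageP[e eG ->].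
  by rewrite gale_dualE vsprojK // mG //; rewrite inE in eG.
rewrite -(dim_relations_supported G) -dimR => <-.
by rewrite addnA; congr (_ + _)%N; rewrite addnAC.
Qed.

End RootRank.

(** * Circulations and face polynomials *)

Section Circulations.
Variables (R : realType) (k : nat) (r : 'I_k -> 'I_k -> nat).
Notation E := (edge r).
Implicit Types (G H : {set E}) (e : E) (m : {ffun E -> R^o}).

(** [m] counts how often a path uses each edge. *)
Lemma walk_flow H u w : connect (adj H) u w ->
  exists m, [/\ forall e, 0 <= m e :> R, m \in supported R H &
    root_comb m = delta_mx 0 u - delta_mx 0 w].
Proof.
move: u w; apply: connect_adj_ind => [u|e w eH _ [m [m0 mH mE]]].
  by exists 0; split=> [e||]; rewrite ?ffunE ?mem0v // linear0 subrr.
exists (edge_delta R e + m); split.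
- by move=> f; rewrite !ffunE addr_ge0.
- by rewrite rpredD //; apply/memv_span/image_f.
- by rewrite linearD /= root_comb_delta mE addrA subrK.
Qed.

(** Each edge of [H] closes up, along a return path, to a circulation positive on it; the sum of
    these is positive on all of [H]. *)
Lemma positive_circulation H : cyclic_part H = H ->
  exists2 m, m \in root_relations R r &
    (forall e, 0 <= m e :> R) /\ (forall e, (m e != 0) = (e \in H)).
Proof.
move=> HH.
have /choice[f fP] e : exists m, [/\ m \in root_relations R r,
    forall e', 0 <= m e' :> R, m \in supported R H & e \in H -> m e != 0].
  have [eH|eH] := boolP (e \in H); last first.
    by exists 0; split; rewrite ?mem0v // => e'; rewrite ffunE.
  have /walk_flow[m [m0 mH mE]] : connect (adj H) (tgt e) (src e).
    by move: eH; rewrite -{1}HH inE => /andP[].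
  exists (edge_delta R e + m); split.
  - by rewrite memv_ker lfunE linearD /= root_comb_delta mE addrA subrK subrr.
  - by move=> f; rewrite !ffunE addr_ge0.
  - by rewrite rpredD //; apply/memv_span/image_f.
  - by move=> _; rewrite !ffunE eqxx gt_eqF // ltr_wpDr.
exists (\sum_e f e); first by apply: rpred_sum => e _; have [] := fP e.
split=> e; rewrite sum_ffunE; first by apply: sumr_ge0 => e' _; have [_ ->] := fP e'.
have [eH|eH] := boolP (e \in H); last first.
  rewrite big1 ?eqxx // => e' _; have [_ _ fH _] := fP e'.
  exact: (supportedP H (f e') fH).
apply/negP; rewrite psumr_eq0 => [/allP/(_ e)|e' _]; last by have [_ ->] := fP e'.
rewrite mem_index_enum => /(_ isT) /=; apply/negP.
by have [_ _ _ ->] := fP e.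
Qed.

Lemma potential_root_comb (p : 'I_k -> R) m :
  potential p (root_comb m) = \sum_e (m e : R) * (p (src e) - p (tgt e)).
Proof.
rewrite linear_sum; apply: eq_bigr => e _.
by rewrite linearZ /= potential_alpha.
Qed.

(** Were an edge [e] of the support on no cycle, the set [U] of vertices reachable from its target
    would receive flow through [e] and lose none, against conservation. *)
Lemma circulation_support m :
  m \in root_relations R r -> (forall e, 0 <= m e :> R) ->
  cyclic_part [set e | m e != 0] = [set e | m e != 0].
Proof.
move=> /root_relationsP mR m0; set S := [set e | m e != 0].
apply/eqP; rewrite eqEsubset cyclic_part_sub; apply/subsetP => e eS.
rewrite in_set eS /=; apply: contraT => nc.
pose U := [set w | connect (adj S) (tgt e) w].
have := potential_root_comb (fun w => (w \in U)%:R) m.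
rewrite /root_comb mR linear0 => /esym /eqP; rewrite -oppr_eq0 -sumrN.
rewrite psumr_eq0 => [/allP/(_ e)|f _].
  rewrite mem_index_enum => /(_ isT) /=.
  rewrite !inE connect0 (negbTE nc) sub0r mulrN1 opprK.
  by move: eS; rewrite inE => /negbTE->.
have [->|mf] := eqVneq (m f : R) 0; first by rewrite mul0r oppr0.
rewrite -mulrN mulr_ge0 ?m0 // opprB subr_ge0 ler_nat !inE.
case: (boolP (connect _ _ (src f))) => // c.
by rewrite (connect_trans c) // connect_edge // inE.
Qed.

(** Nullity is the dimension of the space of supported relations, and a circulation positive on all
    of [G] is not supported on [H]. *)
Lemma card_root_rank_lt H G : cyclic_part G = G -> H \proper G ->
  (#|H| + root_rank R G < #|G| + root_rank R H)%N.
Proof.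
move=> /positive_circulation[m mR [_ mG]] /properP[HG [e eG eH]].
rewrite -(dim_relations_supported R H) -(dim_relations_supported R G).
rewrite addnAC !ltn_add2r.
have sub : (root_relations R r :&: supported R H <=
            root_relations R r :&: supported R G)%VS.
  by apply: capvS (subvv _) (sub_span _) => _ /imageP[f /(subsetP HG) fG ->];
    exact: image_f.
rewrite ltn_neqAle dimvS // andbT; apply/negP => /eqP eqd.
have /eqP HGs : (root_relations R r :&: supported R H)%VS ==
                (root_relations R r :&: supported R G)%VS.
  by rewrite eqEdim sub eqd leqnn.
have : m \in (root_relations R r :&: supported R G)%VS.
  by rewrite memv_cap mR; apply/supportedP => f; rewrite -mG negbK => /eqP.
rewrite -HGs memv_cap => /andP[_ /supportedP/(_ e eH) me].
by have := mG e; rewrite me eqxx eG.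
Qed.

End Circulations.

Lemma coefMXn_lt (R : nzRingType) (p : {poly R}) n i :
  (i < n)%N -> (p * 'X^n)`_i = 0.
Proof. by move=> lt_in; rewrite coefMXn lt_in. Qed.

(** * Edge reversal and the vanishing of low coefficients *)

Section ReverseEdges.
Variables (k : nat) (r : 'I_k -> 'I_k -> nat).
Hypothesis r_sym : forall i j : 'I_k, i != j -> r i j = r j i.
Notation E := (edge r).
Implicit Types (G H X : {set E}) (e : E) (v : 'I_k).

Fact rev_edge_subproof (e : E) : tgt e != src e.
Proof. by rewrite eq_sym; exact: (valP (tag e)). Qed.

Definition rev_edge e : E :=
  @Tagged {ij : 'I_k * 'I_k | ij.1 != ij.2}
    (exist _ (tgt e, src e) (rev_edge_subproof e))
    (fun p => 'I_(r (val p).1 (val p).2))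
    (cast_ord (r_sym (valP (tag e))) (tagged e)).

Lemma rev_edgeK : involutive rev_edge.
Proof.
suff eq_edge (e f : E) : src e = src f -> tgt e = tgt f ->
    tagged e = tagged f :> nat -> e = f by move=> e; exact: eq_edge.
case: e f => [[[i j] ne] le] [[[i' j'] nf] lf]; rewrite /src /tgt /= => ei ej.
case: i' / ei nf lf; case: j' / ej => nf; rewrite (eq_irrelevance nf ne) => lf lef.
by congr existT; exact: val_inj.
Qed.

(** An edge of [X] whose reverse lies in [H :|: X] is on a 2-cycle. Without such an edge, reversal
    would embed [X] into the complement of [H :|: X], which is too small. *)
Lemma exists_cyclic_edge H X :
  X \subset ~: H -> (#|~: H| < 2 * #|X|)%N ->
  exists2 e, e \in X & connect (adj (H :|: X)) (tgt e) (src e).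
Proof.
move=> XH ltX.
have [/existsP[e /andP[eX eHX]]|no] :=
    boolP [exists e, (e \in X) && (rev_edge e \in H :|: X)].
  by exists e => //; exact: (connect_edge eHX).
have sub : rev_edge @: X \subset ~: H :\: X.
  apply/subsetP => _ /imsetP[e eX ->]; rewrite inE in_setC -negb_or orbC -in_setU.
  by apply: contra no => eHX; apply/existsP; exists e; rewrite eX.
have := subset_leq_card sub.
rewrite card_imset; last exact: inv_inj rev_edgeK.
rewrite cardsDS // leq_subRL ?subset_leq_card // addnn -mul2n.
by rewrite leqNgt ltX.
Qed.

(** For totally cyclic [H] the larger root set is the component of [v], which is [edge_closed] as
    [reach_sum_eq0] demands. *)
Lemma reaches_component v G H : H \subset G ->
  reaches [set w | connect (adj H) w v] G = reaches [set v] G.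
Proof.
move=> HG; apply/reachesP/reachesP => RT u; have [w] := RT u.
  rewrite inE => /(connect_adjS HG) wv uw; exists v; rewrite ?inE //.
  exact: connect_trans uw wv.
by move=> /set1P-> uv; exists v; rewrite // inE connect0.
Qed.

(** In the expansion [sum_expX1], a small [Z] contributes a multiple of a power of ['X] above [i],
    and a large [Z] contains an edge on a cycle of [H :|: Z], so that its coefficient is zero. *)
Lemma rooted_poly_coef v H i : cyclic_part H = H -> (2 * i < #|~: H|)%N ->
  (\sum_(Y : {set E} | Y \subset ~: H)
     (reaches [set v] (H :|: Y))%:R * ('X - 1) ^+ #|Y| : {poly int})`_i = 0.
Proof.
move=> HH lti; rewrite (sum_expX1 (fun Y => (reaches [set v] (H :|: Y))%:R)).
rewrite coef_sum big1 // => Z ZH.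
pose T := [set w | connect (adj H) w v].
have -> : \sum_(Y : {set E} | Y \subset Z)
    (-1) ^+ #|Y| * (reaches [set v] (H :|: Y))%:R =
    (reach_sum T H Z)%:~R :> {poly int}.
  rewrite rmorph_sum; apply: eq_bigr => Y _; rewrite reaches_component ?subsetUl //.
  by rewrite rmorphM rmorphXn rmorphN1 rmorph_nat.
have [leZ|ltZ] := leqP (2 * #|Z|) #|~: H|.
  rewrite -mulrA mulrAC coefMXn_lt //.
  by move: lti leZ; move: #|~: H| #|Z| => a b; lia.
have [e eZ ce] := exists_cyclic_edge ZH ltZ.
rewrite (reach_sum_eq0 HH _ eZ ce) ?mulr0 ?coef0 // => f fH.
by rewrite !inE; apply: same_connect (connect_edge fH) _; exact: connect_cyclic_sym.
Qed.

End ReverseEdges.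

(** ['X - 1] has constant term -1, hence is invertible as a power series. *)
Lemma coef_divX1_eq0 (p : {poly int}) c n :
  (forall i, (i < n)%N -> (p * ('X - 1) ^+ c)`_i = 0) ->
  forall i, (i < n)%N -> p`_i = 0.
Proof.
elim: c p => [|c IHc] p p0 i i_n; first by have := p0 i i_n; rewrite expr0 mulr1.
have q0 j : (j < n)%N -> (p * ('X - 1))`_j = 0.
  by apply: IHc => h h_n; rewrite -mulrA -exprS p0.
elim: i i_n => [|i IHi] i_n; have := q0 _ i_n; rewrite mulrBr mulr1 coefB coefMX /=.
  by rewrite sub0r => /eqP; rewrite oppr_eq0 => /eqP.
by rewrite IHi ?(ltnW i_n) // sub0r => /eqP; rewrite oppr_eq0 => /eqP.
Qed.

(** * Graph sums for the g- and h-polynomials of the faces *)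

Section FacePolynomials.
Variables (R : realType) (k : nat) (r : 'I_k -> 'I_k -> nat) (v : 'I_k).
Hypothesis r_sym : forall i j : 'I_k, i != j -> r i j = r j i.
Notation E := (edge r).
Implicit Types (G H : {set E}) (e : E).

(* For totally cyclic [H] this is its number of strong components. *)
Definition corank H : nat := (k - root_rank R H)%N.

(** In [face_g] and [face_h] the truncated subtractions are exact, by [corank_le_rooted] and
    [corank_le_proper]. *)
Definition rooted_weight c H G : {poly int} := ('X - 1) ^+ (#|G| - #|H| - c).

Definition face_g H : {poly int} :=
  \sum_(G : {set E} | reaches [set v] G && (cyclic_part G == H))
     rooted_weight (corank H).-1 H G.

Definition face_h H : {poly int} :=
  \sum_(G : {set E} | reaches [set v] G && (H \proper cyclic_part G))
     rooted_weight (corank H) H G.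

Lemma corank_gt0 H : (0 < corank H)%N.
Proof. by rewrite subn_gt0 (root_rank_lt R v). Qed.

(** [G] has full rank [k.-1], and each edge added to [H] raises the rank by at most one. *)
Lemma corank_le_rooted G H : reaches [set v] G -> H \subset G ->
  ((corank H).-1 <= #|G| - #|H|)%N.
Proof.
move=> Gv /(root_rank_leD R); rewrite (root_rank_rooted R Gv) /corank.
have := root_rank_lt R v H; move: (root_rank R H) (#|G| - #|H|)%N => a b; lia.
Qed.

(** In view of [set_dim_gale_face], this is the drop of dimension from a face to a proper face of
    it. *)
Lemma card_corank_lt H G : cyclic_part G = G -> H \proper G ->
  (#|H| + corank H < #|G| + corank G)%N.
Proof.
move=> GG /(card_root_rank_lt R GG); rewrite /corank.
have := root_rank_lt R v H; have := root_rank_lt R v G.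
by move: (root_rank R H) (root_rank R G) #|H| #|G| => a b c d; lia.
Qed.

Lemma corank_le_proper G H : reaches [set v] G -> H \proper cyclic_part G ->
  (corank H <= #|G| - #|H|)%N.
Proof.
move=> Gv HG; have := corank_le_rooted Gv (cyclic_part_sub G).
have := card_corank_lt (cyclic_part_id G) HG.
have := subset_leq_card (cyclic_part_sub G); have := corank_gt0 (cyclic_part G).
move: (corank H) (corank _) #|H| #|G| #|cyclic_part G| => a b c d f; lia.
Qed.

(** Stanley's recursion for h, with [G] indexing the proper faces: the rooted graphs in [face_h] are
    grouped by cyclic part, and the exponents add up. *)
Lemma face_h_sum H : cyclic_part H = H ->
  \sum_(G : {set E} | (cyclic_part G == G) && (H \proper G))
     face_g G * ('X - 1) ^+ (#|G| + corank G - (#|H| + corank H)).-1 = face_h H.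
Proof.
move=> HH; rewrite /face_h.
rewrite [RHS](partition_big (@cyclic_part k r)
  (fun G => (cyclic_part G == G) && (H \proper G))) /=; last first.
  by move=> G /andP[_ HG]; rewrite cyclic_part_id eqxx.
apply: eq_bigr => G /andP[/eqP GG HG]; rewrite mulr_suml; apply: eq_big.
  by move=> G'; case: eqP => [->|_]; rewrite ?HG ?andbF ?andbT.
move=> G' /andP[G'v /eqP G'G]; rewrite /rooted_weight -exprD; congr (_ ^+ _).
have GG' : G \subset G' by rewrite -G'G cyclic_part_sub.
have := corank_le_rooted G'v GG'; have := card_corank_lt GG HG.
have := subset_leq_card GG'; have := corank_gt0 G; have := proper_card HG.
move: (corank H) (corank G) #|H| #|G| #|G'| => a b c d f; lia.
Qed.

(** A graph contains [H] when its cyclic part equals or properly contains [H]; the factor ['X - 1]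
    makes up for the shift of [corank H] by one. *)
Lemma face_gh_sum H : cyclic_part H = H ->
  face_g H + ('X - 1) * face_h H =
  \sum_(G : {set E} | reaches [set v] G && (H \subset G))
     rooted_weight (corank H).-1 H G.
Proof.
move=> HH; rewrite [RHS](bigID (fun G => cyclic_part G == H)) /=; congr (_ + _).
  apply: eq_bigl => G; case: eqP => [<-|]; rewrite ?andbF ?andbT //.
  by rewrite cyclic_part_sub andbT.
rewrite mulr_sumr; apply: eq_big => [G|G /andP[Gv HG]].
  rewrite -andbA; congr (_ && _); rewrite properEneq eq_sym andbC.
  apply: andb_id2r => _; apply/idP/idP => [HG|/cyclic_part_max]; last exact.
  exact: subset_trans HG (cyclic_part_sub G).
rewrite /rooted_weight -exprS; congr (_ ^+ _).
have := corank_le_proper Gv HG; have := corank_gt0 H.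
move: (corank H) (_ - _)%N => a b; lia.
Qed.

(** Times [('X - 1) ^+ (corank H).-1], this is the sum of [rooted_poly_coef] with [G = H :|: Y]; the
    power is then divided out. *)
Lemma face_gh_coef H i : cyclic_part H = H -> (2 * i < #|~: H|)%N ->
  (face_g H + ('X - 1) * face_h H)`_i = 0.
Proof.
move=> HH lti; rewrite face_gh_sum //.
pose n := (i.+1)%N.
apply: (@coef_divX1_eq0 _ (corank H).-1 n) (ltnSn i) => j j_n.
rewrite -[RHS](rooted_poly_coef r_sym v HH (i := j)); last first.
  by apply: leq_ltn_trans lti; rewrite leq_mul2l.
congr ((_ : {poly int})`_j); rewrite mulr_suml.
rewrite [RHS](bigID (fun Y => reaches [set v] (H :|: Y))) /= [X in _ = _ + X]big1.
  rewrite addr0 [LHS](reindex_onto (fun Y => H :|: Y) (fun G => G :\: H)) /=.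
    apply: eq_big => [Y|Y /andP[/andP[Yv _]] /eqP YH].
      rewrite subsetUl andbT andbC; congr (_ && _).
      by rewrite setDUl setDv set0U -disjoints_subset; apply/eqP/setDidPl.
    rewrite Yv mul1r /rooted_weight -exprD; congr (_ ^+ _).
    have := corank_le_rooted Yv (subsetUl H Y).
    by rewrite -cardsDS ?subsetUl // YH => /subnK.
  by move=> G /andP[_ HG]; rewrite -{1}(setIidPr HG) setID.
by move=> Y /andP[_ /negbTE->]; rewrite mul0r.
Qed.

Lemma face_g_coef H i : cyclic_part H = H -> (0 < i)%N ->
  (2 * i < #|~: H|)%N -> (face_g H)`_i = (face_h H)`_i - (face_h H)`_i.-1.
Proof.
move=> HH i0 /(face_gh_coef HH); rewrite coefD mulrBl mul1r coefB coefXM.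
by case: i i0 => //= i _ /eqP; rewrite addr_eq0 opprB => /eqP.
Qed.

Lemma face_g_coef0 H : cyclic_part H = H -> H != setT ->
  (face_g H)`_0 = (face_h H)`_0.
Proof.
move=> HH HT; have : (2 * 0 < #|~: H|)%N.
  rewrite muln0 card_gt0; apply: contraNneq HT => HC.
  by rewrite -[H]setCK HC setC0.
move/(face_gh_coef HH); rewrite coefD mulrBl mul1r coefB coefXM /= sub0r.
by move/eqP; rewrite subr_eq0 => /eqP.
Qed.

(** A degree bound: if [H] is the cyclic part of [G], no edge of [G :\: H] is on a cycle, so
    [2 * #|G :\: H| <= #|~: H|]. For [G != H] the bound then follows from [corank H >= 2]. *)
Lemma face_g_coef_ge H i : cyclic_part H = H ->
  (corank H <= #|~: H|)%N -> ((#|~: H| - corank H)./2 < i)%N -> (face_g H)`_i = 0.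
Proof.
move=> HH leH lti; rewrite coef_sum big1 // => G /andP[Gv /eqP GH].
rewrite nth_default // /rooted_weight size_exp_XsubC.
have HG : H \subset G by rewrite -GH cyclic_part_sub.
have [GHe|] := eqVneq H G.
  by rewrite GHe subnn; apply: leq_ltn_trans lti; rewrite sub0n.
move=> neHG; have HpG : H \proper G by rewrite properEneq neHG.
have rH := root_rank_ltS R v HH GH HpG.
have : (2 * #|G :\: H| <= #|~: H|)%N.
  rewrite leqNgt; apply/negP => /(exists_cyclic_edge r_sym).
  case=> [|e eGH]; first by rewrite setDE subsetIr.
  rewrite -[X in X :|: _](setIidPr HG) setID => c.
  by move: eGH; rewrite inE -GH inE c andbT => /andP[/negP].
rewrite cardsDS //; move: lti leH rH; rewrite /corank.
by move: #|~: H| (root_rank R H) (_ - #|H|)%N => a b c; lia.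
Qed.

End FacePolynomials.

(** * Faces of the Gale dual polytope *)

Section GaleFaces.
Variables (R : realType) (k : nat) (r : 'I_k -> 'I_k -> nat) (v : 'I_k).
Hypothesis r_gt0 : forall i j : 'I_k, i != j -> (0 < r i j)%N.
Hypothesis r_sym : forall i j : 'I_k, i != j -> r i j = r j i.
Notation E := (edge r).
Notation rels := (root_relations R r).
Notation V := (gale_dual_space R r).
Implicit Types (G H : {set E}) (e : E) (m : {ffun E -> R^o}) (w : E -> R).

(** [H] lists the edges left out; for totally cyclic [H] it is the support of a circulation that
    cuts out the face. *)
Definition gale_face H : set V := [set x | exists w,
  [/\ forall e, 0 <= w e, \sum_e w e = 1, forall e, e \in H -> w e = 0 &
      x = \sum_e w e *: gale_dual R e]]%classic.

Lemma gale_face0 : gale_face set0 = gale_root_polytope R r.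
Proof.
apply/seteqP; split=> x [w].
  by case=> w0 w1 _ xE; exists w.
by case=> w0 w1 xE; exists w; split=> // e; rewrite inE.
Qed.

Lemma mem_gale_face H e : e \notin H -> gale_face H (gale_dual R e).
Proof.
move=> eH; exists (fun f => (f == e)%:R); split=> [f||f fH|].
- exact: ler0n.
- by rewrite (bigD1 e) //= eqxx big1 ?addr0 // => f /negbTE->.
- by case: eqVneq fH eH => // -> ->.
- by rewrite (bigD1 e) //= eqxx scale1r big1 ?addr0 // => f /negbTE->; rewrite scale0r.
Qed.

Lemma gale_face_eq0 H : gale_face H = classical_sets.set0 <-> H = setT.
Proof.
split=> [H0|->]; last first.
  apply/seteqP; split=> // x [w [_ w1 wH _]]; move: w1.
  by rewrite big1 => [/eqP|e _]; [rewrite eq_sym oner_eq0|rewrite wH ?inE].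
apply/setP => e; rewrite inE; apply: contraT => /mem_gale_face.
by rewrite H0.
Qed.

Definition gale_eval_fun m (x : V) : R^o := x (vsproj rels m).

Fact gale_eval_fun_linear m : linear (gale_eval_fun m).
Proof. by move=> a x y; rewrite /gale_eval_fun add_lfunE scale_lfunE. Qed.

HB.instance Definition _ m :=
  GRing.isLinear.Build R _ _ _ (gale_eval_fun m) (gale_eval_fun_linear m).

Definition gale_eval m : 'Hom(V, R^o) := linfun (gale_eval_fun m).

Lemma gale_eval_dual m e : m \in rels -> gale_eval m (gale_dual R e) = m e.
Proof. by move=> mR; rewrite lfunE /= /gale_eval_fun gale_dualE vsprojK. Qed.

Lemma gale_eval_sum m w : m \in rels ->
  gale_eval m (\sum_e w e *: gale_dual R e) = \sum_e w e * (m e : R).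
Proof.
move=> mR; rewrite linear_sum; apply: eq_bigr => e _.
by rewrite linearZ /= gale_eval_dual.
Qed.

(** Reflexivity: the evaluations at a basis of the relations have no common zero but 0, hence span
    all functionals. *)
Lemma gale_functional (l : 'Hom(V, R^o)) :
  exists2 m, m \in rels & forall e, l (gale_dual R e) = m e.
Proof.
pose b := vbasis {: subvs_of rels}.
have : l \in <<[seq gale_eval (vsval u) | u <- b]>>%VS.
  apply: memv_span_functional; apply/subvP => x.
  rewrite memv_bigcap_lker memv_ker => /allP x0.
  suff -> : x = 0 by rewrite linear0.
  apply/lfunP => u; rewrite zero_lfunE (coord_vbasis (memvf u)) linear_sum big1 // => i _.
  have := x0 _ (map_f _ (mem_nth 0 (n := i) _)); rewrite size_tuple ltn_ord.
  move=> /(_ isT); rewrite lfunE /= /gale_eval_fun vsvalK linearZ /= => /eqP->.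
  by rewrite scaler0.
move=> /coord_span lE.
exists (\sum_i coord [tuple of map (fun u => gale_eval (vsval u)) b] i l *: vsval b`_i).
  by apply: rpred_sum => i _; apply: rpredZ; exact: subvsP.
move=> e; rewrite {1}lE sum_lfunE sum_ffunE; apply: eq_bigr => i _.
rewrite scale_lfunE (nth_map 0) ?size_tuple // ffunE gale_eval_dual //.
exact: subvsP.
Qed.

(** Edge reversal negates the sum of all roots. This relation takes the value 1 on the whole
    polytope. *)
Lemma ones_relation : [ffun=> 1] \in rels.
Proof.
apply/root_relationsP; under eq_bigr do rewrite ffunE scale1r.
have alphaN e : alpha R (rev_edge r_sym e) = - alpha R e by rewrite /alpha opprB.
set s := \sum_e _; have : s = - s.
  rewrite {1}/s (reindex_inj (inv_inj (rev_edgeK r_sym))) /= -sumrN.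
  by apply: eq_bigr => e _.
by move/eqP; rewrite -subr_eq0 opprK -mulr2n -scaler_nat scaler_eq0 pnatr_eq0 => /eqP.
Qed.

Lemma rooted_setT : reaches [set v] [set: E].
Proof.
apply/reachesP => u; exists v; first by rewrite inE.
have [->//|uv] := eqVneq u v.
pose e : E := @Tagged {ij : 'I_k * 'I_k | ij.1 != ij.2} (exist _ (u, v) uv)
    (fun p => 'I_(r (val p).1 (val p).2)) (Ordinal (r_gt0 uv)).
exact: (@connect_edge _ _ _ e (in_setT _)).
Qed.

Lemma cyclic_setT : cyclic_part [set: E] = [set: E].
Proof.
rewrite -[RHS](_ : [set e | [ffun=> 1 : R^o] e != 0] = _); last first.
  by apply/setP => e; rewrite !inE ffunE oner_eq0.
rewrite -[in LHS](_ : [set e | [ffun=> 1 : R^o] e != 0] = setT); last first.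
  by apply/setP => e; rewrite !inE ffunE oner_eq0.
by apply: circulation_support ones_relation _ => e; rewrite ffunE ler01.
Qed.

(** At a point of the face, [m] takes a weighted mean of its nonnegative values outside [H], which
    is zero exactly when no weight sits where [m] is positive. *)
Lemma gale_face_cut H G m :
  m \in rels -> (forall e, e \notin H -> 0 <= m e :> R) ->
  (forall e, e \notin H -> (m e != 0) = (e \in G)) -> H \subset G ->
  (forall x, gale_face H x -> 0 <= gale_eval m x :> R) /\
  gale_face G = (gale_face H `&` [set x | gale_eval m x = 0 :> R])%classic.
Proof.
move=> mR m0 mG HG.
have ge0 w e : (forall e, 0 <= w e) -> (forall e, e \in H -> w e = 0) ->
    0 <= w e * (m e : R).
  move=> w0 wH; have [/wH->|/m0] := boolP (e \in H); first by rewrite mul0r.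
  by apply: mulr_ge0.
split=> [_ [w [w0 _ wH ->]]|].
  by rewrite gale_eval_sum //; apply: sumr_ge0 => e _; exact: ge0.
apply/seteqP; split=> x.
  case=> w [w0 w1 wG ->]; split.
    by exists w; split=> // e /(subsetP HG); exact: wG.
  rewrite /= gale_eval_sum // big1 // => e _.
  have [/wG->|eG] := boolP (e \in G); first by rewrite mul0r.
  have eH : e \notin H by apply: contraNN eG; exact: (subsetP HG).
  by have := mG _ eH; rewrite (negbTE eG) => /negbFE/eqP->; rewrite mulr0.
case=> -[w [w0 w1 wH ->]]; rewrite /= gale_eval_sum // => /eqP.
rewrite psumr_eq0 => [/allP wm0|e _]; last exact: ge0.
exists w; split=> // e eG; have [/wH//|eH] := boolP (e \in H).
have := wm0 e; rewrite mem_index_enum => /(_ isT); rewrite mulf_eq0 => /orP[/eqP//|].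
by rewrite -[_ == _]negbK mG // eG.
Qed.

(** A circulation with support [G] vanishes on [gale_face G] but not at [gale_dual e] for [e] in
    [G]. *)
Lemma gale_face_inj H G : cyclic_part H = H -> cyclic_part G = G ->
  gale_face H = gale_face G -> H = G.
Proof.
suff sub H' G' : cyclic_part G' = G' -> gale_face H' = gale_face G' -> G' \subset H'.
  by move=> HH GG HG; apply/eqP; rewrite eqEsubset !sub.
move=> /(positive_circulation R)[m mR [m0 mG]] HG; apply/subsetP => e eG.
apply: contraLR eG => /mem_gale_face; rewrite HG => -[w [w0 w1 wG eE]].
rewrite -mG negbK -(gale_eval_dual e mR) eE gale_eval_sum // big1 // => f _.
have [/wG->|fG] := boolP (f \in G'); first by rewrite mul0r.
by have := mG f; rewrite (negbTE fG) => /negbFE/eqP->; rewrite mulr0.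
Qed.

(** A functional supporting the face gives a relation that is nonnegative only outside [H]. Adding a
    large circulation on [H] makes it nonnegative everywhere, and then its support is totally
    cyclic. *)
Lemma proper_face_gale_face H (F : set V) : cyclic_part H = H ->
  proper_face F (gale_face H) <->
  exists2 G, cyclic_part G = G /\ H \proper G & F = gale_face G.
Proof.
move=> HH; split=> [[[l [c [lec FE]]] FH]|[G [GG HG] ->]]; last first.
  have [m mR [m0 mG]] := positive_circulation R GG.
  have [ge0 GE] := @gale_face_cut H G m mR (fun e _ => m0 e) (fun e _ => mG e)
    (proper_sub HG).
  split; last first.
    by move=> /(gale_face_inj GG HH) GH; rewrite GH properxx in HG.
  exists (- gale_eval m), 0; split=> [x /ge0|]; first by rewrite opp_lfunE oppr_le0.
  rewrite GE; congr (_ `&` _)%classic; apply/seteqP; split=> x /=; rewrite opp_lfunE.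
    by move->; rewrite oppr0.
  by move/eqP; rewrite oppr_eq0 => /eqP.
have [ml mlR mlE] := gale_functional l.
have [p pR [p0 pH]] := positive_circulation R HH.
(* Large enough that [N * p e] exceeds [c - ml e] in absolute value for every [e] in [H]. *)
pose N : R := \sum_(e in H) (`|c - (ml e : R)| + 1) / (p e : R).
(* On [gale_face H] this is [c - l]: the all-ones relation is 1 there and [p] is 0. *)
pose m : {ffun E -> R^o} := [ffun e => c - (ml e : R) + N * (p e : R)].
have mR : m \in rels.
  suff -> : m = c *: [ffun=> 1] - ml + N *: p.
    by rewrite rpredD ?rpredB ?rpredZ // ones_relation.
  by apply/ffunP => e; rewrite !ffunE /GRing.scale /= mulr1.
have mgt0 e : e \in H -> 0 < m e :> R.
  move=> eH; have pe : 0 < p e :> R by rewrite lt_neqAle p0 eq_sym pH eH.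
  rewrite ffunE; have : (`|c - (ml e : R)| + 1) <= N * (p e : R).
    rewrite -ler_pdivrMr // /N (bigD1 e) //= lerDl sumr_ge0 // => f _.
    by rewrite divr_ge0 ?p0 // addr_ge0.
  by have := ler_norm (- (c - (ml e : R))); rewrite normrN; lra.
have mE e : e \notin H -> m e = c - (ml e : R) :> R.
  move=> eH; have := pH e; rewrite ffunE (negbTE eH) => /negbFE/eqP->.
  by rewrite mulr0 addr0.
have m0 e : 0 <= m e :> R.
  have [/mgt0/ltW//|eH] := boolP (e \in H).
  by rewrite mE // subr_ge0 -mlE; apply/lec/mem_gale_face.
pose G := [set e | m e != 0].
have HG : H \subset G by apply/subsetP => e /mgt0; rewrite inE => /gt_eqF->.
have mG e : (m e != 0) = (e \in G) by rewrite in_set.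
have [_ GE] := @gale_face_cut H G m mR (fun e _ => m0 e) (fun e _ => mG e) HG.
have FG : F = gale_face G.
  have eval_m x : gale_face H x -> gale_eval m x = c - l x.
    case=> w [_ w1 wH ->]; rewrite gale_eval_sum // linear_sum /= -[c]mulr1 -w1.
    rewrite mulr_sumr -sumrB; apply: eq_bigr => e _; rewrite linearZ /= mlE.
    have [/wH->|/mE->] := boolP (e \in H); first by rewrite scale0r !mulr0 mul0r subrr.
    by rewrite mulrBr mulrC.
  rewrite FE GE; apply/seteqP; split=> x [Hx] /=; rewrite eval_m //.
    by move=> ->; rewrite subrr.
  by move=> /eqP; rewrite subr_eq0 => /eqP.
exists G => //; split; first exact: circulation_support.
rewrite properEneq HG andbT; apply/eqP => HGe; apply: FH.
by rewrite FG -HGe.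
Qed.

(** The face lies in the affine hyperplane where the all-ones relation is 1, so its dimension is one
    less than that of its linear span, known from [dim_gale_span]. *)
Lemma set_dim_gale_face H : cyclic_part H = H ->
  set_dim (gale_face H) = #|~: H|%:Z - (corank R H)%:Z.
Proof.
move=> HH; have kr : (k - root_rank R [set: E] = 1)%N.
  by rewrite (root_rank_rooted R rooted_setT); case: (k) v => [[]|n _] //=; lia.
have [HT|/set0Pn[e0]] := eqVneq (~: H) set0.
  have {}HT : H = setT by rewrite -[H]setCK HT setC0.
  by rewrite (gale_face_eq0 H).2 // set_dim0 HT setCT cards0 /corank kr sub0r.
rewrite inE => e0H.
have Fn0 : gale_face H != classical_sets.set0.
  by apply/eqP => /gale_face_eq0 HT; rewrite HT inE in e0H.
rewrite /set_dim (negbTE Fn0).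
pose W := gale_span R H.
have gW e : e \notin H -> gale_dual R e \in W.
  by move=> eH; apply/memv_span/image_f; rewrite inE.
have gale1 e : gale_eval [ffun=> 1] (gale_dual R e) = 1 :> R.
  by rewrite gale_eval_dual ?ones_relation // ffunE.
pose U := (W :&: lker (gale_eval [ffun=> 1]))%VS.
have dimU : (\dim U + 1)%N = \dim W.
  rewrite -[RHS](limg_ker_dim (gale_eval [ffun=> 1])); congr (_ + _)%N.
  apply/esym/eqP; rewrite eqn_leq; apply/andP; split.
    by apply: leq_trans (dimvS (subvf _)) _; rewrite dimvf.
  rewrite lt0n dimv_eq0 -lkerE; apply/negP => /subvP/(_ _ (gW _ e0H)).
  by rewrite memv_ker gale1 oner_eq0.
have affU : in_affine_subspace (gale_face H) (\dim U).
  exists (gale_dual R e0), U; split=> // _ [w [w0 w1 wH ->]].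
  rewrite memv_cap; apply/andP; split.
    apply: rpredB; last exact: gW.
    apply: rpred_sum => e _; have [/wH->|/gW] := boolP (e \in H).
      by rewrite scale0r mem0v.
    exact: rpredZ.
  rewrite memv_ker linearB /= gale_eval_sum ?ones_relation // gale1.
  by under eq_bigr do rewrite ffunE mulr1; rewrite w1 subrr.
have minU d : in_affine_subspace (gale_face H) d -> (\dim U <= d)%N.
  case=> x [U' [<- FU']].
  have : (W <= U' + <[gale_dual R e0]>)%VS.
    apply/span_subvP => _ /imageP[e eH ->].
    rewrite -[gale_dual R e](subrK (gale_dual R e0)) memv_add ?memv_line //.
    have -> : gale_dual R e - gale_dual R e0 =
              (gale_dual R e - x) - (gale_dual R e0 - x).
      by rewrite opprB addrA subrK.
    by rewrite rpredB // FU' //; apply: mem_gale_face; rewrite // -in_setC.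
  move/dimvS; rewrite -dimU => /leq_trans/(_ (dimv_add_leqif _ _)).
  rewrite dim_vline => leU; rewrite -(leq_add2r 1); apply: leq_trans leU _.
  by rewrite leq_add2l leq_b1.
case: ex_minnP => d /asboolP/minU Ud /(_ _ (asboolT affU)) dU.
have -> : d = \dim U by apply/eqP; rewrite eqn_leq dU.
have := dim_gale_span R H rooted_setT; rewrite -/W -dimU -(cardsC H).
have := root_rank_lt R v H; rewrite /corank.
move: (\dim U) (root_rank R H) #|H| #|~: H| => a b c f; lia.
Qed.

(** By [gale_face_inj] the sum over proper faces becomes the one in [face_h_sum]. *)
Lemma stanley_h_gale_face H : cyclic_part H = H -> H != setT ->
  (forall G, cyclic_part G = G -> H \proper G ->
     stanley_g (gale_face G) = face_g R v G) ->
  stanley_h (gale_face H) = face_h R v H.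
Proof.
move=> HH HT gG.
have Fn0 : gale_face H != classical_sets.set0.
  by apply: contraNneq HT => /gale_face_eq0 ->.
rewrite stanley_hE //.
pose P : set {set E} := [set G | cyclic_part G = G /\ H \proper G]%classic.
have -> : [set F | proper_face F (gale_face H)]%classic = (gale_face @` P)%classic.
  apply/seteqP; split=> F /=.
    by move=> /(proper_face_gale_face _ HH)[G PG ->]; exists G.
  by case=> G PG <-; apply/(proper_face_gale_face _ HH); exists G.
rewrite fsbig_image; last first.
  by move=> G G' /set_mem[GG _] /set_mem[GG' _]; exact: gale_face_inj.
have sP : ([set` [seq G <- index_enum {set E} | G \in P]] `<=` P)%classic.
  by move=> G /=; rewrite mem_filter => /andP[/set_mem].
rewrite (fsbigE [seq G <- index_enum {set E} | G \in P]) //; first last.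
- by move=> G /mem_set PG; rewrite mem_filter PG mem_index_enum.
- exact/filter_uniq/index_enum_uniq.
rewrite big_filter_cond -(face_h_sum R v HH); apply: eq_big => [G|G].
  rewrite andbb.
  apply/idP/andP => [/set_mem[GG HG]|[/eqP GG HG]]; first by rewrite GG.
  exact: mem_set.
rewrite andbb => /set_mem[GG HG]; rewrite gG //; congr (_ * _ ^+ _).
rewrite !set_dim_gale_face //; have := card_corank_lt R v GG HG.
have := cardsC H; have := cardsC G.
move: #|H| #|G| #|~: H| #|~: G| (corank R H) (corank R G) #|_| => a b c d f g h.
lia.
Qed.

(** Induction from small faces, that is from large [H]. Up to half the dimension the coefficients
    agree by [face_g_coef0] and [face_g_coef]; above it both sides vanish, by [face_g_coef_ge]. *)
Lemma stanley_g_gale_face H : cyclic_part H = H ->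
  stanley_g (gale_face H) = face_g R v H.
Proof.
have [n] := ubnP #|~: H|; elim: n => // n IHn in H *; rewrite ltnS => Hn HH.
have [HT|HT] := eqVneq H setT.
  (* For the empty face the only graph is the full one, with weight 1. *)
  rewrite HT (gale_face_eq0 _).2 // stanley_g0 /face_g (big_pred1 setT) => [|G].
    by rewrite /rooted_weight subnn sub0n expr0.
  apply/andP/eqP => [[_ /eqP GT]|->].
    by apply/eqP; rewrite -subTset -GT cyclic_part_sub.
  by rewrite rooted_setT cyclic_setT.
have Fn0 : gale_face H != classical_sets.set0.
  by apply: contraNneq HT => /gale_face_eq0 ->.
have hE : stanley_h (gale_face H) = face_h R v H.
  apply: stanley_h_gale_face => // G GG HG; apply: IHn => //.
  apply: leq_trans Hn; apply: proper_card.
  by rewrite properE !setCS -properE.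
have leH : (corank R H <= #|~: H|)%N.
  have := set_dim_ge0 Fn0; rewrite set_dim_gale_face //.
  by move: #|~: H| (corank R H) => a b; lia.
have c0 := corank_gt0 R v H.
rewrite stanley_gE // hE set_dim_gale_face // subzn // absz_nat.
apply/polyP => i; rewrite coefD coefC [X in _ + X]coef_sum.
set d := ((#|~: H| - corank R H)./2)%N.
have [i0|i0] := posnP i.
  rewrite i0 big1_seq ?addr0 => [|j].
    by rewrite -(face_g_coef0 _ v).
  rewrite mem_index_iota coefZ coefXn /= => /andP[/negP].
  by case: j => // j; rewrite mulr0.
rewrite add0r.
have [leid|ltdi] := leqP i d.
  rewrite (bigD1_seq i) ?mem_index_iota ?iota_uniq ?i0 //= coefZ coefXn eqxx mulr1.
  rewrite big1 ?addr0 => [|j ji]; last by rewrite coefZ coefXn eq_sym (negbTE ji) mulr0.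
  rewrite -face_g_coef //.
  by move: leid leH c0; rewrite /d; move: #|~: H| (corank R H) => a b; lia.
rewrite face_g_coef_ge // big1_seq // => j /andP[_].
rewrite mem_index_iota ltnS => /andP[_ jd]; rewrite coefZ coefXn.
by rewrite gtn_eqF ?mulr0 //; apply: leq_ltn_trans jd ltdi.
Qed.

End GaleFaces.

Theorem theorem5p5 (R : realType) (k : nat) (k_ge2 : (2 <= k)%N)
    (r : 'I_k -> 'I_k -> nat)
    (r_gt0 : forall i j : 'I_k, i != j -> (0 < r i j)%N)
    (r_sym : forall i j : 'I_k, i != j -> r i j = r j i) :
  stanley_h (gale_root_polytope R r) \Po ('X + 1) =
  \sum_(G : {set edge r} |
        `[< has_dicycle G /\ rooted_at (Ordinal (ltnW k_ge2)) G >])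
     'X^(#|G| - k).
Proof.
pose v := Ordinal (ltnW k_ge2); pose w : 'I_k := Ordinal k_ge2.
have c0 : cyclic_part (set0 : {set edge r}) = set0.
  by apply/eqP; rewrite -subset0 cyclic_part_sub.
(* Two distinct vertices provide an edge, so the polytope is nonempty. *)
have T0 : (set0 : {set edge r}) != setT.
  have vw : v != w by [].
  pose e : edge r := @Tagged {ij : 'I_k * 'I_k | ij.1 != ij.2} (exist _ (v, w) vw)
    (fun p => 'I_(r (val p).1 (val p).2)) (Ordinal (r_gt0 _ _ vw)).
  by apply/eqP => /setP/(_ e); rewrite !inE.
rewrite -gale_face0 (@stanley_h_gale_face R k r v r_gt0 r_sym _ c0 T0); last first.
  by move=> G GG _; exact: stanley_g_gale_face.
rewrite /face_h raddf_sum /=; apply: eq_big => [G|G _].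
  rewrite proper0; apply/andP/asboolP => -[].
    by move=> /reaches_rooted_at Gv /has_dicycleP.
  by move=> /has_dicycleP Gc /reaches_rooted_at.
have -> : corank R (set0 : {set edge r}) = k.
  rewrite /corank /root_rank (_ : root_span _ _ = 0%VS) ?dimv0 ?subn0 //.
  by apply/eqP; rewrite -subv0; apply: root_span_subP => e; rewrite inE.
(* Substituting ['X + 1] turns ['X - 1] into ['X]. *)
by rewrite /rooted_weight cards0 subn0 rmorphXn rmorphB rmorph1 /= comp_polyX addrK.
Qed.
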